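(* Let $\mathcal H$ be a real Hilbert space, let $\Phi:\mathcal H\to\mathbb R\cup\{+\infty\}$ be a convex lower semicontinuous proper function, and let $\Psi:\mathcal H\to\mathbb R$ be a convex continuously differentiable function whose gradient is $L$-Lipschitz continuous ($L>0$). Suppose that $\operatorname{argmin}(\Phi+\Psi)$ is nonempty. Let $\alpha\ge3$, $0<s<\frac1L$, and let $(g_k)_{k\ge0}$ be a sequence in $\mathcal H$ with $\sum_{k\in\mathbb N}k\|g_k\|<+\infty$. Let $(x_k)$ be a sequence generated, from initial points $x_{-1},x_0\in\mathcal H$, by the algorithm, for $k\ge0$, $$y_k=x_k+\frac{k-1}{k+\alpha-1}(x_k-x_{k-1}),\qquad x_{k+1}=\operatorname{prox}_{s\Phi}\bigl(y_k-s(\nabla\Psi(y_k)-g_k)\bigr).$$ Then $$(\Phi+\Psi)(x_k)-\min(\Phi+\Psi)=\mathcal O\left(\frac1{k^2}\right).$$ Precisely, for any $x^*\in\operatorname{argmin}(\Phi+\Psi)$, $$(\Phi+\Psi)(x_k)-\min(\Phi+\Psi)\le\frac{C(\alpha-1)}{2s(k+\alpha-2)^2},$$ with $$C=\mathcal G(0)+2s\left(\sum_{j=0}^{\infty}(j+\alpha-1)\|g_j\|\right)\left(\sqrt{\frac{\mathcal G(0)}{\alpha-1}}+\frac{2s}{\alpha-1}\sum_{j=0}^{\infty}(j+\alpha-1)\|g_j\|\right),$$ where $$\mathcal G(0)=\frac{2s}{\alpha-1}(\alpha-2)^2\bigl((\Phi+\Psi)(x_0)-\min(\Phi+\Psi)\bigr)+(\alpha-1)\|y_0-x^*\|^2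 .$$
   Context: For $\gamma>0$ and a convex lower semicontinuous proper function $\Phi$, the proximal operator is $\operatorname{prox}_{\gamma\Phi}(x)=\operatorname{argmin}_{\xi\in\mathcal H}\left\{\Phi(\xi)+\frac1{2\gamma}\|\xi-x\|^2\right\}=(I+\gamma\,\partial\Phi)^{-1}(x)$, where $\partial\Phi$ is the convex subdifferential. If $(\Phi+\Psi)(x_0)=+\infty$, the constants $\mathcal G(0)$ and $C$ are read as $+\infty$. *)

(* Defs.v *)
From HB Require Import structures.
From mathcomp Require Import all_boot all_order all_algebra.
From mathcomp Require Import sesquilinear.
From mathcomp Require Import all_classical all_reals all_analysis.

Set Implicit Arguments.
Unset Strict Implicit.
Unset Printing Implicit Defensive.

Import Order.TTheory GRing.Theory Num.Theory.
Import numFieldNormedType.Exports.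

Local Open Scope classical_set_scope.
Local Open Scope convex_scope.
Local Open Scope ring_scope.

(* A real Hilbert space is a complete normed module whose norm comes from a
   positive definite symmetric bilinear form. *)
Definition induces_norm (R : realType) (H : normedModType R)
    (dot : {dot H for idfun}) : Prop :=
  forall u : H, `|u| ^+ 2 = dot u u.

Definition is_gradient (R : realType) (H : normedModType R)
    (dot : {dot H for idfun}) (f : H -> R) (gradf : H -> H) : Prop :=
  forall x : H, differentiable f x /\ forall v : H, 'd f x v = dot (gradf x) v.

(* For t = 0 or t = 1 the inequality is trivial because 0 * +oo = 0 in \bar R. *)
Definition econvex_function (R : realType) (H : lmodType R)
    (E := convex_lmodType H) (f : E -> \bar R) : Prop :=
  forall (t : {i01 R}) (x y : E),
    (f (x <| t |> y) <= (t%:num)%:E * f x + (1 - t%:num)%:E * f y)%E.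

Definition proper_function (R : realType) (T : Type) (f : T -> \bar R) : Prop :=
  (forall x, f x != -oo%E) /\ exists x, f x != +oo%E.

Definition argmin (R : realType) (T : Type) (f : T -> \bar R) : set T :=
  [set x | forall y, (f x <= f y)%E].

(* The minimum of f, whenever argmin f is nonempty. *)
Definition emin (R : realType) (T : Type) (f : T -> \bar R) : \bar R :=
  ereal_inf (range f).

(* The argmin is kept as a set; for f convex, lower semicontinuous and proper it
   is a singleton, and p = prox_(gamma f) x reads `prox gamma f x p`. *)
Definition prox (R : realType) (H : normedModType R) (gamma : R)
    (f : H -> \bar R) (x : H) : set H :=
  argmin (fun xi : H => (f xi + ((2 * gamma)^-1 * `|xi - x| ^+ 2)%:E)%E).

(* k |-> x_(k-1), where xm1 stands for x_(-1). *)
Definition previous (T : Type) (xm1 : T) (x : nat -> T) (k : nat) : T :=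
  if k is j.+1 then x j else xm1.

(* Main.v *)
Require Import Defs.
From HB Require Import structures.
From mathcomp Require Import all_boot all_order all_algebra.
From mathcomp Require Import sesquilinear.
From mathcomp Require Import all_classical all_reals all_analysis.
From mathcomp Require Import ring lra.

Set Implicit Arguments.
Unset Strict Implicit.
Unset Printing Implicit Defensive.

Import Order.TTheory GRing.Theory Num.Theory.
Import numFieldNormedType.Exports.

Local Open Scope classical_set_scope.
Local Open Scope ring_scope.

(* With a = alpha - 1, t_k = k + a and z_k = (t_k y_k - k x_k) / a, the energy
   G(k) = (2 s / a) (k + alpha - 2)^2 (Theta(x_k) - min Theta) + a |z_k - x^*|^2
   is almost nonincreasing.  The proximal gradient inequality at x_(k+1),
   averaged over the points x_k and x^* with weights k / t_k and a / t_k, gives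
     G(k+1) <= G(k) + 2 s t_k |g_k| |z_(k+1) - x^*|,
   where alpha >= 3 enters through k t_k <= (k + alpha - 2)^2.  Since
   |z_k - x^*| <= sqrt (G(k) / a), a quadratic Gronwall argument bounds G.
   When Theta(x_0) = +oo, the rate follows by starting the energy at k = 1,
   because every proximal point lies in the domain of Phi. *)

(** * A limiting argument and the geometry of the inner product *)

(** Stands for letting [t] tend to 0 in the first-order arguments below. If [b < a], then [t = 1]
    forces [c >= a - b > 0], and [t = (a - b) / (2 * c)] is an admissible value that gives a
    contradiction. *)
Lemma le_of_le_addMt (R : realFieldType) (a b c : R) :
  (forall t, 0 < t -> t <= 1 -> a <= b + t * c) -> a <= b.
Proof.
move=> abc; rewrite leNgt; apply/negP => ba.
have abc1 := abc 1 ltr01 (lexx _).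
have c0 : 0 < c by lra.
have t0 : 0 < (a - b) / (2 * c) by rewrite divr_gt0 ?subr_gt0 ?mulr_gt0.
have t1 : (a - b) / (2 * c) <= 1.
  by rewrite ler_pdivrMr ?mulr_gt0//; lra.
have := abc _ t0 t1; rewrite leNgt => /negP; apply.
have -> : (a - b) / (2 * c) * c = (a - b) / 2 by field; rewrite gt_eqF.
lra.
Qed.

Section inner_product.
Variables (R : realType) (H : normedModType R) (dot : {dot H for idfun}).
Implicit Types u v w : H.

Lemma dotC u v : dot u v = dot v u.
Proof. by rewrite hermC expr0 mul1r. Qed.

Lemma dotDl u v w : dot (u + v) w = dot u w + dot v w.
Proof. exact: linearDl. Qed.

Lemma dotNl u w : dot (- u) w = - dot u w.
Proof. exact: linearNl. Qed.

Lemma dotZl a u w : dot (a *: u) w = a * dot u w.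
Proof. exact: linearZl_LR. Qed.

Lemma dotDr u v w : dot w (u + v) = dot w u + dot w v.
Proof. by rewrite dotC dotDl !(dotC w). Qed.

Lemma dotNr u w : dot w (- u) = - dot w u.
Proof. by rewrite dotC dotNl dotC. Qed.

Lemma dotZr a u w : dot w (a *: u) = a * dot w u.
Proof. by rewrite dotC dotZl dotC. Qed.

Definition dotE := (dotDl, dotDr, dotNl, dotNr, dotZl, dotZr).

Hypothesis dot_norm : induces_norm dot.

(** Cauchy-Schwarz, from expanding the square of the norm of [|v| u - |u| v]. *)
Lemma dot_le_norm u v : dot u v <= `|u| * `|v|.
Proof.
have [->|u0] := eqVneq u 0.
  by rewrite -(scale0r 0) dotZl mul0r mulr_ge0.
have [->|v0] := eqVneq v 0.
  by rewrite -(scale0r 0) dotZr mul0r mulr_ge0.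
have un : 0 < `|u| by rewrite normr_gt0.
have vn : 0 < `|v| by rewrite normr_gt0.
have : 0 <= `|(`|v| *: u - `|u| *: v)| ^+ 2 by rewrite sqr_ge0.
rewrite dot_norm !dotE -!dot_norm (dotC v u).
rewrite [X in _ <= X](_ : _ =
  2 * (`|u| * `|v|) * (`|u| * `|v| - dot u v)); last by ring.
by rewrite pmulr_rge0 ?subr_ge0// !mulr_gt0.
Qed.

End inner_product.
Arguments dotC {R H dot} u v.

(** * Convex functions with Lipschitz gradient *)

Section gradient.
Variables (R : realType) (H : normedModType R) (dot : {dot H for idfun}).
Variables (Psi : H -> R) (gradPsi : H -> H).
Hypothesis Psi_grad : is_gradient dot Psi gradPsi.

Lemma is_derive_line (y v : H) (t : R) :
  is_derive t 1 (fun t => Psi (y + t *: v)) (dot (gradPsi (y + t *: v)) v).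
Proof.
have [dPsi gPsi] := Psi_grad (y + t *: v).
have line : differentiable (fun t : R => y + t *: v) t by [].
have dline : 'd (fun t : R => y + t *: v) t 1 = v.
  by rewrite diffD// diff_val/= diff_val/= add0r scale1r.
apply: DeriveDef.
  exact/diff_derivable/differentiable_comp.
rewrite deriveE; last exact: differentiable_comp.
by rewrite -gPsi (@diff_comp _ _ _ _ (fun t : R => y + t *: v) Psi)//= dline.
Qed.

End gradient.

(** Turns a convex combination into a step of length [t] from [y] towards [x], the form used for
    directional expansions. *)
Lemma conv_lmodE (R : numDomainType) (E : lmodType R) (t : {i01 R}) (x y : E) :
  conv t (x : convex_lmodType E) y = y + t%:num *: (x - y) :> E.
Proof.
rewrite {1}/conv/= /unstable.onem scalerBr scalerBl scale1r.
by rewrite [RHS]addrCA.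
Qed.

Section smooth_convex.
Variables (R : realType) (H : normedModType R) (dot : {dot H for idfun}).
Hypothesis dot_norm : induces_norm dot.
Variables (Psi : H -> R) (gradPsi : H -> H).
Hypothesis Psi_grad : is_gradient dot Psi gradPsi.
Variable L : R.
Hypothesis L_ge0 : 0 <= L.
Hypothesis gradPsi_lip : L.-lipschitz gradPsi.

Lemma dot_gradB_le (y v : H) (t : R) : 0 <= t ->
  `|dot (gradPsi (y + t *: v)) v - dot (gradPsi y) v| <= t * (L * `|v| ^+ 2).
Proof.
move=> t0.
have lip : `|gradPsi (y + t *: v) - gradPsi y| <= L * (t * `|v|).
  have := gradPsi_lip (x := (y + t *: v, y)) (conj I I).
  by rewrite /= [y + _]addrC addrK normrZ ger0_norm.
rewrite -dotNl -dotDl.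
have absdot u : `|dot u v| <= `|u| * `|v|.
  by rewrite ler_norml lerNl -dotNl -{1}(normrN u) !(dot_le_norm dot_norm).
apply: (le_trans (absdot _)); apply: (le_trans (ler_wpM2r _ lip)) => //.
by rewrite le_eqVlt; apply/orP; left; apply/eqP; ring.
Qed.

(** Convexity bounds the increment of [Psi] from [y] to [y + t v] by [t (Psi xi - Psi y)]. The mean
    value theorem writes this increment as [t] times a slope at some [y + c v] with [0 < c < t], the
    Lipschitz bound moves the slope to [y] at a cost proportional to [t], and [t] is then sent to
    0. *)
Lemma gradient_ineq (Psi_convex : convex_function (E := H) [set: H] Psi)
  (y xi : H) : dot (gradPsi y) (xi - y) <= Psi xi - Psi y.
Proof.
set v := xi - y.
apply: (@le_of_le_addMt _ _ _ (L * `|v| ^+ 2)) => t t0 t1.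
have [c c0t] : exists2 c, c \in `]0, t[%R &
    Psi (y + t *: v) - Psi (y + 0 *: v) =
    dot (gradPsi (y + c *: v)) v * (t - 0).
  apply: (@MVT _ (fun t => Psi (y + t *: v))) => //.
    by move=> c _; exact: is_derive_line.
  apply: derivable_within_continuous => c _.
  by have [] := is_derive_line Psi_grad y v c.
rewrite scale0r addr0 subr0 => mvt.
move: c0t; rewrite in_itv/= => /andP[c0 ct].
have := Psi_convex (Itv01 (ltW t0) t1) xi y (in_setT _) (in_setT _).
rewrite conv_lmodE convRE /= -/v /unstable.onem => cvx.
have : dot (gradPsi y) v - t * (L * `|v| ^+ 2) <= dot (gradPsi (y + c *: v)) v.
  have := dot_gradB_le y v (ltW c0).
  rewrite ler_norml => /andP[+ _].
  have : c * (L * `|v| ^+ 2) <= t * (L * `|v| ^+ 2).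
    by rewrite ler_wpM2r ?(ltW ct)// mulr_ge0.
  lra.
move=> /(ler_wpM2r (ltW t0)); rewrite -mvt => h.
rewrite -(ler_pM2l t0); lra.
Qed.

(** The mean value theorem replaces integration of the gradient: subtracting the quadratic majorant
    along the segment leaves a function [h] with nonpositive derivative on []0, 1[], so
    [h 1 <= h 0]. *)
Lemma descent_ineq (y p : H) :
  Psi p <= Psi y + dot (gradPsi y) (p - y) + L / 2 * `|p - y| ^+ 2.
Proof.
have dq (a b t : R) :
    is_derive t 1 (a *: id + b *: id ^+ 2) (a + b * (2 * t)).
  have did := is_derive_id t (1 : R).
  have dd := is_deriveD (is_deriveZ a did) (is_deriveZ b (is_deriveX 2 did)).
  apply: (is_derive_eq dd).
  by rewrite /GRing.scale/= expr1 !mulr1.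
set v := p - y; set A := dot (gradPsi y) v; set B := L / 2 * `|v| ^+ 2.
pose h : R -> R := (fun t => Psi (y + t *: v)) - (A *: id + B *: id ^+ 2).
have hE (t : R) : h t = Psi (y + t *: v) - (A * t + B * t ^+ 2) by [].
have dh (t : R) : is_derive t 1 h
    (dot (gradPsi (y + t *: v)) v - (A + B * (2 * t))).
  exact: (is_deriveB (is_derive_line Psi_grad y v t) (dq A B t)).
have [|c] := MVT ltr01 (fun t _ => dh t).
  by apply: derivable_within_continuous => t _; have [] := dh t.
rewrite in_itv/= => /andP[c0 _].
rewrite !hE scale0r scale1r addr0 subr0 mulr1 (addrC y) subrK.
have := dot_gradB_le y v (ltW c0).
rewrite ler_norml => /andP[_]; rewrite -/A /B; lra.
Qed.

End smooth_convex.

(** * The proximal gradient inequality and the one-step energy estimate *)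

Section proximal_gradient.
Variables (R : realType) (H : normedModType R) (dot : {dot H for idfun}).
Hypothesis dot_norm : induces_norm dot.

(** States that [(x - p) / gamma] is a subgradient of [Phi] at [p]. Minimality at [p] is tested
    against [p + t (xi - p)]; convexity and division by [t] leave a quadratic remainder of order
    [t], which vanishes in the limit. *)
Lemma prox_ineq (Phi : H -> \bar R) (gamma : R) (x p : H) :
  0 < gamma -> econvex_function Phi -> proper_function Phi ->
  prox gamma Phi x p ->
  Phi p \is a fin_num /\ forall xi, Phi xi \is a fin_num ->
    fine (Phi p) <= fine (Phi xi) + gamma^-1 * dot (p - x) (xi - p).
Proof.
move=> gamma0 Phi_convex [PhiNy [x0 Phix0]] /= pmin.
have Phip : Phi p \is a fin_num.
  rewrite fin_numE PhiNy/=; apply/eqP => Phip.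
  have := pmin x0; rewrite Phip addye// leye_eq.
  by move: Phix0; case: (Phi x0) (PhiNy x0).
split=> // xi Phixi.
apply: (@le_of_le_addMt _ _ _ ((2 * gamma)^-1 * `|xi - p| ^+ 2)) => t t0 t1.
have cvx := Phi_convex (Itv01 (ltW t0) t1) xi p.
rewrite conv_lmodE /= -(fineK Phip) -(fineK Phixi) in cvx.
have := pmin (p + t *: (xi - p)).
have := PhiNy (p + t *: (xi - p)).
(* The value [+oo] is excluded by the finite convexity bound, and [-oo] by properness. *)
move: cvx; case: (Phi (p + t *: (xi - p))) => // r.
rewrite -(fineK Phip) -!EFinM -!EFinD !lee_fin => cvx _.
have -> : p + t *: (xi - p) - x = (p - x) + t *: (xi - p) by rewrite addrAC.
have -> : `|(p - x + t *: (xi - p))| ^+ 2 = `|p - x| ^+ 2 +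
    2 * t * dot (p - x) (xi - p) + t ^+ 2 * `|xi - p| ^+ 2.
  rewrite !dot_norm; move: (p - x) (xi - p) => u v.
  by rewrite !dotE (dotC v u); ring.
rewrite invfM => min; rewrite -(ler_pM2l t0).
have : t * (gamma^-1 * dot (p - x) (xi - p)) =
  2^-1 * gamma^-1 * (2 * t * dot (p - x) (xi - p)) by field; rewrite gt_eqF.
lra.
Qed.

(** Adds the subgradient inequality of [Phi] at [p], the gradient inequality of [Psi] from [y] to
    [xi] and the descent inequality from [y] to [p]. The gradient terms cancel, and [s < 1 / L] lets
    the descent remainder be absorbed into [|p - y|^2 / (2 s)]. *)
Lemma forward_backward_ineq (Phi : H -> \bar R) (Psi : H -> R)
    (gradPsi : H -> H) (L s : R) (g y p : H) :
  econvex_function Phi -> proper_function Phi ->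
  convex_function (E := H) [set: H] Psi -> is_gradient dot Psi gradPsi ->
  L.-lipschitz gradPsi -> 0 < L -> 0 < s -> s < L^-1 ->
  prox s Phi (y - s *: (gradPsi y - g)) p ->
  forall xi, Phi xi \is a fin_num ->
  fine (Phi p) + Psi p <= fine (Phi xi) + Psi xi +
    ((2 * s)^-1 * `|p - y| ^+ 2 + s^-1 * dot (p - y) (xi - p) +
     dot g (p - xi)).
Proof.
move=> Phi_convex Phi_proper Psi_convex Psi_grad lip L0 s0 sL pprox xi Phixi.
have [_ /(_ _ Phixi) Phi_ineq] := prox_ineq s0 Phi_convex Phi_proper pprox.
have := gradient_ineq dot_norm Psi_grad (ltW L0) lip Psi_convex y xi.
have := descent_ineq dot_norm Psi_grad lip y p.
have : L / 2 * `|p - y| ^+ 2 <= (2 * s)^-1 * `|p - y| ^+ 2.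
  rewrite ler_wpM2r ?sqr_ge0// invfM mulrC ler_wpM2l ?invr_ge0//.
  by rewrite -(invrK L) lef_pV2 ?posrE ?invr_gt0// ltW.
move: Phi_ineq.
have -> : s^-1 * dot (p - (y - s *: (gradPsi y - g))) (xi - p) =
    s^-1 * dot (p - y) (xi - p) + dot (gradPsi y) (xi - p) + dot g (p - xi).
  by rewrite !dotE; field; rewrite gt_eqF.
rewrite !dotE; lra.
Qed.

(* With [x = x_k], [y = y_k] and [p = x_(k+1)], the vectors [u] and [w] are
   [z_k - x^*] and [z_(k+1) - x^*].  The conclusion is the sum of the last two
   hypotheses with weights [1] and [a], multiplied by [2 * s * t / a]. *)
Lemma energy_step (s a k thx thp : R) (x xstar y p g : H)
    (t := k + a) (u := a^-1 *: (t *: y - k *: x) - xstar)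
    (w := a^-1 *: (t *: p - k *: x) - xstar)
    (Q := fun xi => (2 * s)^-1 * `|p - y| ^+ 2 + s^-1 * dot (p - y) (xi - p) +
       dot g (p - xi)) :
  0 < s -> 0 < a -> 0 <= k ->
  k * thp <= k * (thx + Q x) -> thp <= Q xstar ->
  2 * s / a * t ^+ 2 * thp + a * `|w| ^+ 2 <=
  2 * s / a * (t * k) * thx + a * `|u| ^+ 2 + 2 * s * t * `|g| * `|w|.
Proof.
move=> s0 a0 k0 ineqx ineqxstar.
have t0 : 0 <= t by rewrite addr_ge0// ltW.
have gw : dot g w <= `|g| * `|w| by exact: dot_le_norm.
have {gw} : 2 * s * t * dot g w <= 2 * s * t * (`|g| * `|w|).
  by rewrite ler_wpM2l// !mulr_ge0// ltW.
have : 2 * s / a * t * (t * thp) <=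
    2 * s / a * t * (k * (thx + Q x) + a * Q xstar).
  rewrite ler_wpM2l//; first by rewrite !mulr_ge0 ?invr_ge0// ltW.
  by rewrite /t mulrDl lerD// ler_pM2l.
suff : 2 * s / a * t * (k * (thx + Q x) + a * Q xstar) =
   2 * s / a * (t * k) * thx + a * `|u| ^+ 2 - a * `|w| ^+ 2 +
   2 * s * t * dot g w by lra.
rewrite /Q /u /w /t !dot_norm !dotE.
(* Symmetric products are brought to one order, so that [field] sees the same atoms on both
   sides. *)
rewrite (dotC y x) (dotC p x) (dotC y p).
rewrite (dotC xstar) (dotC xstar x) (dotC xstar p).
field.
by rewrite !gt_eqF.
Qed.

End proximal_gradient.

(** * Discrete Gronwall inequality, minimum value and weighted series *)

(** By induction each [a n.+1] is at most [M = r + B / c], where [c r^2 = E 0]. Indeed [M] dominates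
    the positive root of [c a^2 = c r^2 + B a], so a larger [a n.+1] would contradict
    [c * a n.+1 ^+ 2 <= E n.+1]. *)
Lemma quadratic_gronwall (R : rcfType) (c B : R) (E a b : nat -> R) :
  0 < c -> (forall n, 0 <= a n) -> (forall n, 0 <= b n) ->
  (forall n, c * a n ^+ 2 <= E n) ->
  (forall n, E n.+1 <= E n + b n * a n.+1) ->
  (forall n, \sum_(i < n) b i <= B) ->
  forall n, E n <= E 0%N + B * (Num.sqrt (E 0%N / c) + B / c).
Proof.
move=> c0 a0 b0 aE Estep bB.
set r := Num.sqrt _; set M := r + B / c.
have E0 : 0 <= E 0%N by apply: le_trans (aE _); rewrite mulr_ge0 ?sqr_ge0 ?ltW.
have B0 : 0 <= B by have := bB 0%N; rewrite big_ord0.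
have r0 : 0 <= r by exact: sqrtr_ge0.
have M0 : 0 <= M by rewrite addr_ge0// divr_ge0// ltW.
have r2 : c * r ^+ 2 = E 0%N.
  by rewrite sqr_sqrtr ?divr_ge0 ?(ltW c0)// mulrC divfK// gt_eqF.
suff EM n : E n <= E 0%N + (\sum_(i < n) b i) * M.
  by move=> n; apply: le_trans (EM n) _; rewrite lerD2l ler_wpM2r.
elim: n => [|n IH]; first by rewrite big_ord0 mul0r addr0.
rewrite big_ord_recr/= mulrDl addrA.
have En1 : E n.+1 <= E 0%N + (\sum_(i < n) b i) * M + b n * a n.+1.
  by apply: le_trans (Estep n) _; rewrite lerD2r.
apply: (le_trans En1); rewrite lerD2l ler_wpM2l//.
rewrite leNgt; apply/negP => Ma.
have rM : r <= M by rewrite lerDl divr_ge0// ltW.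
have ub : c * a n.+1 ^+ 2 <= c * r ^+ 2 + B * a n.+1.
  apply: le_trans (aE _) _; apply: (le_trans En1).
  rewrite r2 -addrA lerD2l.
  (* Since [M < a n.+1] is assumed, the factor [M] may be raised to [a n.+1]; the coefficients then
     add up to at most [B]. *)
  apply: (@le_trans _ _ ((\sum_(i < n.+1) b i) * a n.+1)); last first.
    by rewrite ler_wpM2r.
  by rewrite big_ord_recr/= mulrDl lerD2r ler_wpM2l ?sumr_ge0// ltW.
have : c * r ^+ 2 + B * a n.+1 < c * a n.+1 ^+ 2.
  apply: (@le_lt_trans _ _ (c * (M * a n.+1))); last first.
    by rewrite ltr_pM2l// expr2 ltr_pM2r// (le_lt_trans M0).
  have -> : c * (M * a n.+1) = c * (r * a n.+1) + B * a n.+1.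
    by rewrite /M; field; rewrite gt_eqF.
  rewrite lerD2r ler_pM2l// expr2 ler_wpM2l//.
  by rewrite ltW// (le_lt_trans rM).
by rewrite ltNge ub.
Qed.

Lemma emin_argmin (R : realType) (T : Type) (f : T -> \bar R) (x : T) :
  argmin f x -> emin f = f x.
Proof.
move=> fx; apply/le_anti/andP; split.
  by apply: ereal_inf_lbound; exists x.
by apply: le_ereal_inf_tmp => _ [y _ <-]; exact: fx.
Qed.

(** The term at 0, which has weight 0 in the hypothesis, is split off; for [k >= 1] the comparison
    is [k + a <= (1 + a) k]. *)
Lemma nneseries_shift_weight_fin (R : realType) (a : R) (u : nat -> R) :
  0 <= a -> (forall k, 0 <= u k) ->
  (\sum_(0 <= k <oo) (k%:R * u k)%:E < +oo)%E ->
  (\sum_(0 <= k <oo) ((k%:R + a) * u k)%:E)%E \is a fin_num.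
Proof.
move=> a0 u0.
have ku0 k : (0 <= (k%:R * u k)%:E :> \bar R)%E by rewrite lee_fin mulr_ge0.
have kau0 k : (0 <= ((k%:R + a) * u k)%:E :> \bar R)%E.
  by rewrite lee_fin mulr_ge0// addr_ge0.
rewrite ge0_fin_numE ?nneseries_ge0//.
rewrite (nneseries_split 0%N 1%N)// (nneseries_split 0%N 1%N)// !add0n.
rewrite !big_nat1 mul0r add0e => sum_fin.
rewrite lte_add_pinfty ?ltry//.
rewrite -(@nneseries_addn _ _ 1%N)// in sum_fin.
rewrite -(@nneseries_addn _ _ 1%N)//.
apply: (@le_lt_trans _ _
  (\sum_(0 <= k <oo) ((1 + a)%:E * ((k + 1)%:R * u (k + 1)%N)%:E))%E).
  apply: lee_nneseries => k *; first exact: kau0.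
  rewrite -EFinM lee_fin mulrA ler_wpM2r// mulrDl mul1r lerD2l.
  by rewrite ler_peMr// ler1n addn1.
rewrite nneseriesZl//.
by rewrite lte_mul_pinfty// lee_fin addr_ge0.
Qed.

(** * The energy along the iterates *)

Section inertial_forward_backward.
Variables (R : realType) (H : normedModType R) (dot : {dot H for idfun}).
Hypothesis dot_norm : induces_norm dot.
Variables (Phi : H -> \bar R) (Psi : H -> R) (gradPsi : H -> H).
Hypothesis Phi_convex : econvex_function Phi.
Hypothesis Phi_proper : proper_function Phi.
Hypothesis Psi_convex : convex_function (E := H) [set: H] Psi.
Hypothesis Psi_grad : is_gradient dot Psi gradPsi.
Variable L : R.
Hypotheses (L_gt0 : 0 < L) (gradPsi_lip : L.-lipschitz gradPsi).
Variables (alpha s : R).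
Hypothesis alpha_ge3 : 3 <= alpha.

Let alpha1_gt0 : 0 < alpha - 1. Proof. by move: alpha_ge3; lra. Qed.

Hypotheses (s_gt0 : 0 < s) (s_ltLV : s < L^-1).
Variables (g : nat -> H) (xm1 : H) (x y : nat -> H).
Hypothesis y_def : forall k : nat,
  y k = x k + ((k%:R - 1) / (k%:R + alpha - 1)) *: (x k - previous xm1 x k).
Hypothesis x_def : forall k : nat,
  prox s Phi (y k - s *: (gradPsi (y k) - g k)) (x k.+1).
Variable xstar : H.

Definition composite (u : H) : \bar R := (Phi u + (Psi u)%:E)%E.
Local Notation Theta := composite.

Hypothesis xstar_argmin : argmin Theta xstar.

Let Theta_fin u : (Theta u \is a fin_num) = (Phi u \is a fin_num).
Proof. by rewrite /composite fin_numD andbT. Qed.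

Lemma Theta_xstar_fin : Theta xstar \is a fin_num.
Proof.
have [PhiNy [u Phiu]] := Phi_proper.
rewrite fin_numE; apply/andP; split.
  by rewrite /composite; case: (Phi xstar) (PhiNy xstar).
apply/eqP => Thetaxstar.
have := xstar_argmin u; rewrite Thetaxstar leye_eq /composite.
by case: (Phi u) Phiu.
Qed.

Lemma Theta_iterate_fin k : Theta (x k.+1) \is a fin_num.
Proof.
rewrite Theta_fin.
by have [] := prox_ineq dot_norm s_gt0 Phi_convex Phi_proper (x_def k).
Qed.

(** Since [fine] sends [+oo] to 0, the value is meaningful only where [Theta (x k)] is finite,
    whence the finiteness assumptions below. *)
Definition gap k : R := fine (Theta (x k)) - fine (Theta xstar).

Lemma gapE k : Theta (x k) \is a fin_num ->
  (Theta (x k) - emin Theta)%E = (gap k)%:E.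
Proof.
move=> xk; rewrite (emin_argmin xstar_argmin) /gap EFinB !fineK//.
exact: Theta_xstar_fin.
Qed.

Lemma gap_ge0 k : Theta (x k) \is a fin_num -> 0 <= gap k.
Proof. by move=> xk; rewrite subr_ge0 fine_le// Theta_xstar_fin. Qed.

(* The point [z_k] of the energy. *)
Definition anchor k : H :=
  (alpha - 1)^-1 *: ((k%:R + (alpha - 1)) *: y k - k%:R *: x k).

Lemma anchor0 : anchor 0%N = y 0%N.
Proof.
by rewrite /anchor add0r scale0r subr0 scalerA mulVf ?scale1r// gt_eqF.
Qed.

(** The inertial coefficient of [y k.+1] is [k / (k + alpha)], and the weight [k + 1 + (alpha - 1)]
    cancels its denominator. This identifies the vector [w] of [energy_step] with the next anchor
    minus [xstar]. *)
Lemma anchorS k : anchor k.+1 =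
  (alpha - 1)^-1 *: ((k%:R + (alpha - 1)) *: x k.+1 - k%:R *: x k).
Proof.
rewrite /anchor y_def /=; congr (_ *: _).
have k0 : 0 <= k%:R :> R by [].
rewrite scalerDr scalerA [(_ + (alpha - 1)) * _](_ : _ = k%:R); last first.
  by rewrite -natr1; field; rewrite gt_eqF// -addrA ltr_wpDl// addr_ge0.
rewrite scalerBr addrA (addrAC _ (- (k%:R *: x k))); congr (_ - _).
by rewrite -scalerDl -scalerBl -natr1; congr (_ *: _); ring.
Qed.

Definition energy k : R :=
  2 * s / (alpha - 1) * (k%:R + alpha - 2) ^+ 2 * gap k +
  (alpha - 1) * `|anchor k - xstar| ^+ 2.

Definition weight k : R := (k%:R + (alpha - 1)) * `|g k|.

Lemma energyS_le k : Theta (x k) \is a fin_num ->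
  energy k.+1 <= energy k + 2 * s * weight k * `|anchor k.+1 - xstar|.
Proof.
move=> xk.
have fb := forward_backward_ineq dot_norm Phi_convex Phi_proper Psi_convex
  Psi_grad gradPsi_lip L_gt0 s_gt0 s_ltLV (x_def k).
have xk1 := Theta_iterate_fin k; have xst := Theta_xstar_fin.
have fineTheta u : Theta u \is a fin_num ->
    fine (Theta u) = fine (Phi u) + Psi u.
  by rewrite Theta_fin => ufin; rewrite /composite fineD.
have gap_le u : Theta u \is a fin_num ->
    gap k.+1 <= fine (Theta u) - fine (Theta xstar) +
      ((2 * s)^-1 * `|x k.+1 - y k| ^+ 2 +
       s^-1 * dot (x k.+1 - y k) (u - x k.+1) + dot (g k) (x k.+1 - u)).
  move=> ufin; have := ufin; rewrite Theta_fin => /fb.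
  by rewrite /gap !fineTheta//; lra.
have := @energy_step _ _ _ dot_norm s (alpha - 1) k%:R (gap k) (gap k.+1)
  (x k) xstar (y k) (x k.+1) (g k) s_gt0 alpha1_gt0 (ler0n R k).
rewrite -/(anchor k) -anchorS => step.
have {}step := step (ler_wpM2l (ler0n R k) (gap_le _ xk)).
have := gap_le _ xst; rewrite subrr add0r => /step {}step.
have c0 : 0 <= 2 * s / (alpha - 1) by rewrite divr_ge0 ?mulr_ge0 ?ltW.
(* The difference of the two quadratic factors is [k (alpha - 3) + (alpha - 2)^2], nonnegative
   because [alpha >= 3]. *)
have : 2 * s / (alpha - 1) * ((k%:R + (alpha - 1)) * k%:R) * gap k <=
    2 * s / (alpha - 1) * (k%:R + alpha - 2) ^+ 2 * gap k.
  rewrite ler_wpM2r ?gap_ge0// ler_wpM2l//.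
  have k0 : 0 <= k%:R :> R by [].
  by move: alpha_ge3; nra.
rewrite /energy /weight -[k.+1%:R]natr1.
rewrite (_ : k%:R + 1 + alpha - 2 = k%:R + (alpha - 1)); last by ring.
by rewrite !mulrA in step *; lra.
Qed.

Variable S : R.
Hypothesis sum_weight_le : forall n, \sum_(i < n) weight i <= S.

Let weight_ge0 k : 0 <= weight k.
Proof. by rewrite mulr_ge0// addr_ge0// ltW. Qed.

(** The starting index [m] is left free so that the energy can be started at 1 when [Theta (x 0)] is
    infinite. *)
Lemma energy_bound m : Theta (x m) \is a fin_num -> forall n,
  energy (m + n) <= energy m +
    2 * s * S * (Num.sqrt (energy m / (alpha - 1)) + 2 * s / (alpha - 1) * S).
Proof.
move=> xm n.
have xmn k : Theta (x (m + k)) \is a fin_num.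
  case: k => [|k]; first by rewrite addn0.
  by rewrite addnS; exact: Theta_iterate_fin.
have := @quadratic_gronwall R (alpha - 1) (2 * s * S) (fun k => energy (m + k))
  (fun k => `|anchor (m + k) - xstar|) (fun k => 2 * s * weight (m + k))
  alpha1_gt0.
rewrite addn0 [2 * s * S / _](mulrAC _ S); apply=> // [k|k|k|k].
- by rewrite mulr_ge0// mulr_ge0// ltW.
- rewrite lerDr mulr_ge0 ?gap_ge0//.
  by rewrite mulr_ge0 ?sqr_ge0// divr_ge0 ?mulr_ge0// ltW.
- by rewrite addnS; exact: energyS_le.
- rewrite -mulr_sumr ler_pM2l ?mulr_gt0//.
  (* The weights shifted by [m] form the end of the sum of the first [m + k] weights. *)
  apply: le_trans (sum_weight_le (m + k)).
  by rewrite big_split_ord/= lerDr sumr_ge0.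
Qed.

Lemma gap_le_energy k : Theta (x k) \is a fin_num ->
  gap k <= energy k * ((alpha - 1) / (2 * s * (k%:R + alpha - 2) ^+ 2)).
Proof.
move=> xk; have k0 : 0 <= k%:R :> R by [].
have d0 : 0 < k%:R + alpha - 2 by move: alpha_ge3; lra.
rewrite mulrA ler_pdivlMr; last by rewrite !mulr_gt0// exprn_gt0.
rewrite /energy [leRHS]mulrDl -[leLHS]addr0 lerD//.
  rewrite le_eqVlt; apply/orP; left; apply/eqP; field.
  by rewrite gt_eqF.
by rewrite !mulr_ge0 ?sqr_ge0// ltW.
Qed.

End inertial_forward_backward.

(** * The convergence rate with its explicit constant *)

Theorem theorem5p1 (R : realType) (H : completeNormedModType R)
    (dot : {dot H for idfun}) (dot_norm : induces_norm dot)
    (Phi : H -> \bar R) (Psi : H -> R) (gradPsi : H -> H)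
    (Phi_convex : econvex_function Phi)
    (Phi_lsc : lower_semicontinuous Phi)
    (Phi_proper : proper_function Phi)
    (Psi_convex : convex_function (E := H) [set: H] Psi)
    (Psi_grad : is_gradient dot Psi gradPsi)
    (gradPsi_cont : continuous gradPsi)
    (L : R) (L_gt0 : 0 < L) (gradPsi_lip : L.-lipschitz gradPsi)
    (Theta : H -> \bar R := fun x => (Phi x + (Psi x)%:E)%E)
    (argmin_neq0 : argmin Theta !=set0)
    (alpha s : R) (alpha_ge3 : 3 <= alpha) (s_gt0 : 0 < s) (s_ltLV : s < L^-1)
    (g : nat -> H)
    (g_summable : (\sum_(0 <= k <oo) (k%:R * `|g k|)%:E < +oo)%E)
    (xm1 : H) (x y : nat -> H)
    (y_def : forall k : nat,
       y k = x k + ((k%:R - 1) / (k%:R + alpha - 1)) *: (x k - previous xm1 x k))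
    (x_def : forall k : nat,
       prox s Phi (y k - s *: (gradPsi (y k) - g k)) (x k.+1)) :
  ((\forall k \near \oo, (Theta (x k) - emin Theta)%E \is a fin_num) /\
   (fun k : nat => fine (Theta (x k) - emin Theta)%E : R^o) =O_\oo
     (fun k : nat => (k%:R ^+ 2)^-1 : R^o)) /\
  (forall xstar : H, argmin Theta xstar ->
   let G0 : \bar R :=
     ((2 * s / (alpha - 1) * (alpha - 2) ^+ 2)%:E * (Theta (x 0%N) - emin Theta)
      + ((alpha - 1) * `|y 0%N - xstar| ^+ 2)%:E)%E in
   let S : \bar R :=
     (\sum_(0 <= j <oo) ((j%:R + alpha - 1) * `|g j|)%:E)%E in
   let C : \bar R :=
     (G0 + (2 * s)%:E * S *
       (er_map Num.sqrt (G0 * ((alpha - 1)^-1)%:E)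
        + (2 * s / (alpha - 1))%:E * S))%E in
   forall k : nat,
     (Theta (x k) - emin Theta
       <= C * ((alpha - 1) / (2 * s * (k%:R + alpha - 2) ^+ 2))%:E)%E).
Proof.
have g0 k : 0 <= `|g k| by [].
have alpha1_ge0 : 0 <= alpha - 1 by lra.
set S : \bar R := (\sum_(0 <= j <oo) ((j%:R + alpha - 1) * `|g j|)%:E)%E.
have Sfin : S \is a fin_num.
  rewrite /S (eq_eseriesr (g := fun j => ((j%:R + (alpha - 1)) * `|g j|)%:E)).
    exact: nneseries_shift_weight_fin.
  by move=> j _; rewrite addrA.
have partial_le n : \sum_(j < n) weight alpha g j <= fine S.
  rewrite -lee_fin fineK// -sumEFin /S.
  rewrite -(big_mkord xpredT (fun j => (weight alpha g j)%:E)).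
  under eq_bigr do rewrite /weight addrA.
  apply: nneseries_lim_ge => j _ _.
  by rewrite lee_fin mulr_ge0// -addrA addr_ge0.
have xSfin k : Theta (x k.+1) \is a fin_num.
  exact: (Theta_iterate_fin dot_norm Psi Phi_convex Phi_proper s_gt0 x_def).
pose E xstar := energy Phi Psi alpha s x y xstar.
have E_le xstar m n : argmin Theta xstar -> Theta (x m) \is a fin_num ->
    E xstar (m + n)%N <= E xstar m + 2 * s * fine S *
      (Num.sqrt (E xstar m / (alpha - 1)) + 2 * s / (alpha - 1) * fine S).
  move=> xstar_min xm.
  exact: (energy_bound dot_norm Phi_convex Phi_proper Psi_convex Psi_grad
    L_gt0 gradPsi_lip alpha_ge3 s_gt0 s_ltLV y_def x_def xstar_min partial_le).
have scale_ge0 k : 0 <= (alpha - 1) / (2 * s * (k%:R + alpha - 2) ^+ 2).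
  apply: divr_ge0 => //; apply: mulr_ge0; last exact: sqr_ge0.
  by rewrite mulr_ge0// ltW.
have gapE' xstar k : argmin Theta xstar -> Theta (x k) \is a fin_num ->
    (Theta (x k) - emin Theta)%E = (gap Phi Psi x xstar k)%:E.
  by move=> xstar_min; exact: gapE.
have gap_le xstar k : argmin Theta xstar -> Theta (x k) \is a fin_num ->
    gap Phi Psi x xstar k <=
    E xstar k * ((alpha - 1) / (2 * s * (k%:R + alpha - 2) ^+ 2)).
  by move=> xstar_min; exact: gap_le_energy.
split.
  have [xstar xstar_min] := argmin_neq0.
  split.
    near=> k; have k0 : (0 < k)%N by near: k; exact: nbhs_infty_gt.
    by rewrite -(prednK k0) (gapE' xstar).
  (* The energy starts at 1: [x 0] may lie outside the domain of [Phi], but [x 1] is a proximal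
     point. *)
  pose C := E xstar 1%N + 2 * s * fine S *
      (Num.sqrt (E xstar 1%N / (alpha - 1)) + 2 * s / (alpha - 1) * fine S).
  (* The absolute value and the added 1 only ensure a positive constant. *)
  apply/eqO_exP; exists (`|C * (alpha - 1) / (2 * s)| + 1) => //.
  near=> k; have k0 : (0 < k)%N by near: k; exact: nbhs_infty_gt.
  have kfin : Theta (x k) \is a fin_num by rewrite -(prednK k0).
  have k0R : 0 < k%:R :> R by rewrite ltr0n.
  have d0 : k%:R <= k%:R + alpha - 2 by lra.
  rewrite (gapE' xstar)//= [`|gap _ _ _ _ _|]ger0_norm; last exact: gap_ge0.
  rewrite [`|_ ^- 2|]ger0_norm ?invr_ge0 ?sqr_ge0//.
  apply: (le_trans (gap_le _ _ xstar_min kfin)).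
  have EC : E xstar k <= C by rewrite -(prednK k0) -add1n; exact: E_le.
  apply: (le_trans (ler_wpM2r (scale_ge0 k) EC)).
  have D2 : 0 <= ((k%:R + alpha - 2) ^+ 2)^-1 by rewrite invr_ge0 sqr_ge0.
  rewrite invfM !mulrA; apply: (le_trans (ler_wpM2r D2 (ler_norm _))).
  apply: ler_pM => //; first by rewrite lerDl.
  have D0 : 0 < k%:R + alpha - 2 by exact: lt_le_trans d0.
  by rewrite lef_pV2 ?posrE ?exprn_gt0// lerXn2r// nnegrE ltW.
move=> xstar xstar_min G0 /= k.
have z0 : anchor alpha x y 0 = y 0%N by exact: anchor0.
(* If [Theta (x 0)] is finite, the bound is the energy estimate started at 0. Otherwise [C] is [+oo]
   and the right-hand side is infinite. *)
have [x0fin|x0fin] := boolP (Theta (x 0%N) \is a fin_num).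
  have G0E : G0 = (E xstar 0%N)%:E.
    rewrite /G0 (gapE' xstar)// -EFinM -EFinD /E /energy z0.
    by rewrite add0r.
  have kfin : Theta (x k) \is a fin_num by case: k.
  rewrite G0E (gapE' xstar)// -/S -(fineK Sfin) /=.
  rewrite -!(EFinM, EFinD) lee_fin.
  apply: (le_trans (gap_le _ _ xstar_min kfin)).
  apply: ler_wpM2r; first exact: scale_ge0.
  by have := E_le xstar 0%N k xstar_min x0fin; rewrite add0n.
have x0y : Theta (x 0%N) = +oo%E.
  have [PhiNy _] := Phi_proper; move: x0fin; rewrite /Theta.
  by case: (Phi (x 0%N)) (PhiNy (x 0%N)).
have xstar_fin : Theta xstar \is a fin_num by exact: Theta_xstar_fin.
have G0y : G0 = +oo%E.
  rewrite /G0 x0y (emin_argmin xstar_min) -(fineK xstar_fin) addye//.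
  (* The coefficient must be strictly positive because [0 * +oo = 0]; here [alpha - 2 > 0]. *)
  rewrite gt0_muley//.
  rewrite lte_fin mulr_gt0//; last by rewrite exprn_gt0//; lra.
  by apply: divr_gt0; [exact: mulr_gt0|lra].
have alpha1_gt0 : 0 < alpha - 1 by lra.
have S0 : (0 <= S)%E.
  by apply: nneseries_ge0 => j _ _; rewrite lee_fin mulr_ge0// -addrA addr_ge0.
have s0 : 0 <= s by exact: ltW.
(* The product in [C] may be 0 when [S = 0], so only its nonnegativity is used: adding it to [+oo]
   gives [+oo]. *)
rewrite G0y -/S gt0_mulye ?lte_fin ?invr_gt0//= addye; last first.
  rewrite gt_eqF// (lt_le_trans (ltNyr 0))// !mule_ge0 ?lee_fin ?mulr_ge0//.
  by rewrite adde_ge0// mule_ge0// lee_fin divr_ge0// mulr_ge0.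
rewrite gt0_mulye ?leey// lte_fin divr_gt0//.
apply: mulr_gt0; first exact: mulr_gt0.
have k0 : 0 <= k%:R :> R by [].
by rewrite exprn_gt0//; lra.
Unshelve. all: by end_near. Qed.
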